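(* For $\mathcal{E}\subseteq S(n)$ let \[\Phi(\mathcal{E}):=\left\{P\overline{\lambda}(Y)\;|\;P\in\mathcal{P}(n),\,Y\in\mathcal{E}\right\}\subseteq\mathbb{R}^n.\] Then $\Phi$ is a one-to-one correspondence (bijection) from the symmetric subsets of $S(n)$ to the symmetric subsets of $\mathbb{R}^n$, and its inverse is \[\Phi^{-1}(\varepsilon)=\left\{Q(\operatorname{diag}y)Q^T\;|\;Q\in O(n),\,y\in\varepsilon\right\}.\] Moreover, the restriction of $\Phi$ to the symmetric convex bodies $\mathcal{K}$ of $S(n)$ is given by \[\Phi(\mathcal{K})=\left\{\operatorname{diag}Y\;|\;Y\in\mathcal{K}\right\}\] and is a one-to-one correspondence between the symmetric convex bodies of $S(n)$ and the symmetric convex bodies of $\mathbb{R}^n$.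
   Context: Here $n\geq 2$. $S(n)$ is the space of symmetric real $n\times n$ matrices, with inner product $\langle X,Y\rangle=\operatorname{tr}(XY)$; $O(n)$ is the set of orthogonal $n\times n$ matrices; $\mathcal{P}(n)\subseteq O(n)$ is the set of $n\times n$ permutation matrices. For $Y\in S(n)$, $\overline{\lambda}(Y):=(\lambda_1(Y),\dots,\lambda_n(Y))^T\in\mathbb{R}^n$ is the vector of eigenvalues of $Y$ (with multiplicity) in increasing order $\lambda_1(Y)\leq\cdots\leq\lambda_n(Y)$. For $y\in\mathbb{R}^n$, $\operatorname{diag}y\in S(n)$ is the diagonal matrix with diagonal entries $y_1,\dots,y_n$; for $Y\in S(n)$, $\operatorname{diag}Y:=(Y_{11},\dots,Y_{nn})^T\in\mathbb{R}^n$ is the vector of diagonal entries. A subset $\mathcal{E}\subseteq S(n)$ is symmetric if $\mathcal{E}=\{Q^TYQ\;|\;Y\in\mathcal{E}\}$ for all $Q\in O(n)$. A subset $\varepsilon\subseteq\mathbb{R}^n$ is symmetric if $\varepsilon=\{Py\;|\;y\in\varepsilon\}$ for all $P\in\mathcal{P}(n)$. A convex body (in $S(n)$ or in $\mathbb{R}^n$) is a nonempty, convex and compact subset. *)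

(* Defs.v *)
From HB Require Import structures.
From mathcomp Require Import all_boot all_order all_algebra.
From mathcomp Require Import all_classical all_reals all_analysis.

Set Implicit Arguments.
Unset Strict Implicit.
Unset Printing Implicit Defensive.

Import Order.TTheory GRing.Theory Num.Theory.
Import numFieldNormedType.Exports.

Local Open Scope classical_set_scope.
Local Open Scope ring_scope.

Section Definitions.
Context {R : realType} {n : nat}.

(* S(n) is a subset of 'M[R]_n, so that "E is a subset of S(n)" reads
   [E `<=` symmetric_matrices]. It is a closed linear subspace, hence convexity
   and compactness may be taken in 'M[R]_n, whose topology (that of entrywise
   convergence) is the one induced by <X, Y> = tr(XY) on S(n). *)
Definition symmetric_matrices : set 'M[R]_n := [set Y | Y^T = Y].

Definition orthogonal_matrices : set 'M[R]_n := [set Q | Q^T *m Q = 1%:M].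

Definition permutation_matrices : set 'M[R]_n := [set P | is_perm_mx P].

(* The eigenvalues of Y are counted with their multiplicity as roots of the
   characteristic polynomial. *)
Definition is_ordered_spectrum (Y : 'M[R]_n) (y : 'cV[R]_n) : Prop :=
  (forall i j : 'I_n, (i <= j)%N -> y i 0 <= y j 0) /\
  char_poly Y = \prod_(i < n) ('X - (y i 0)%:P).

(* For symmetric Y exactly one vector satisfies [is_ordered_spectrum Y]; the
   value 0 is a default for those Y whose eigenvalues are not all real. *)
Definition ordered_spectrum (Y : 'M[R]_n) : 'cV[R]_n :=
  xget 0 [set y | is_ordered_spectrum Y y].

Definition diag_of_vector (y : 'cV[R]_n) : 'M[R]_n := diag_mx y^T.

Definition diag_of_matrix (Y : 'M[R]_n) : 'cV[R]_n := \col_i Y i i.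

Definition symmetric_mxset (E : set 'M[R]_n) : Prop :=
  E `<=` symmetric_matrices /\
  forall Q, orthogonal_matrices Q -> E = [set Q^T *m Y *m Q | Y in E].

Definition symmetric_vecset (e : set 'cV[R]_n) : Prop :=
  forall P, permutation_matrices P -> e = [set P *m y | y in e].

Definition convex_body_mx (K : set 'M[R]_n) : Prop :=
  [/\ K `<=` symmetric_matrices, K !=set0, convex_set K & compact K].

Definition convex_body_vec (k : set 'cV[R]_n) : Prop :=
  [/\ k !=set0, convex_set k & compact k].

Definition Phi (E : set 'M[R]_n) : set 'cV[R]_n :=
  [set P *m ordered_spectrum Y | P in permutation_matrices & Y in E].

Definition Psi (e : set 'cV[R]_n) : set 'M[R]_n :=
  [set Q *m diag_of_vector y *m Q^T | Q in orthogonal_matrices & y in e].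

End Definitions.

(* Main.v *)
(** Both halves rest on the equivalence [z \in Phi E <-> diag z \in E] for a
    symmetric set [E], a consequence of the spectral theorem.

    For a convex symmetric [K], averaging [Y] with its conjugates by coordinate
    reflections shows that [diag (diag Y)] lies in [K]; so [Phi K] is the image
    of [K] under the linear map [diag].

    For a convex symmetric [k], convexity of [Psi k] reduces, after
    diagonalizing a convex combination, to the claim that the diagonal of
    [V (diag y) V^T] lies in [k] whenever [V] is orthogonal and [y] is in [k].
    This diagonal is [S y] with the doubly stochastic [S i j = (V i j)^2].
    Instead of Birkhoff's theorem we use nearest-point separation together with
    the rearrangement inequality [<a, S y> <= <a, y>] for similarly sorted [a]
    and [y]. *)

Require Import Defs.
From HB Require Import structures.
From mathcomp Require Import all_boot all_order all_algebra.
From mathcomp Require Import all_classical all_reals all_analysis.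
From mathcomp Require Import fingroup perm complex lra ring.

Set Implicit Arguments.
Unset Strict Implicit.
Unset Printing Implicit Defensive.

Import Order.TTheory GRing.Theory Num.Theory.
Import numFieldNormedType.Exports.

Local Open Scope classical_set_scope.
Local Open Scope ring_scope.

(** * The real spectral theorem *)

Section SpectralTheorem.
Variable R : realType.

(** Over the complex numbers [A] becomes Hermitian, so the complex spectral theorem provides an
    eigenvalue, and it is real. Being a root of the characteristic polynomial, it is an eigenvalue
    of [A] over [R] as well, with a real eigenvector. *)
Lemma symmetric_eigenvector n (A : 'M[R]_n.+1) : A^T = A ->
  exists a, exists2 v : 'rV[R]_n.+1, v *m A = a *: v & v != 0.
Proof.
move=> symA; pose AC : 'M[R[i]]_n.+1 := map_mx (real_complex R) A.
have hermA : AC \is hermsymmx.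
  apply: realsym_hermsym.
    apply/is_hermitianmxP; rewrite expr0 scale1r map_mx_id //.
    by apply/matrixP => i j; rewrite !mxE -{1}symA mxE.
  by apply/mxOverP => i j; rewrite !mxE; apply/complex_realP; exists (A i j).
have /orthomx_spectralP := hermitian_normalmx hermA.
have /mxOverP/(_ 0 0) := hermitian_spectral_diag_real hermA.
have := spectral_unit AC.
move: (spectralmx AC) (spectral_diag AC) => P d Punit /complex_realP[a da] ACE.
have : eigenvalue AC (real_complex R a).
  apply/eigenvalueP; exists (row 0 P); last first.
    by apply/eqP => r0; move: Punit; rewrite -row_free_unit => /row_freeP[B PB];
      have := congr1 (row 0) PB; rewrite row_mul r0 mul0mx => /rowP/(_ 0);
      rewrite !mxE eqxx => /esym/eqP; rewrite oner_eq0.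
  rewrite ACE !rowE !mulmxA mulmxK // -(rowE 0 (diag_mx d)) row_diag_mx.
  by rewrite -scalemxAl da.
by rewrite eigenvalue_map => /eigenvalueP[v]; exists a, v.
Qed.

Lemma row_sqr_norm_gt0 n (w : 'rV[R]_n) : w != 0 -> 0 < (w *m w^T) 0 0.
Proof.
move=> w0; rewrite lt_neqAle; apply/andP; split; last first.
  by rewrite mxE sumr_ge0 // => i _; rewrite mxE -expr2 sqr_ge0.
apply: contra w0 => /eqP/esym; rewrite mxE => w0.
apply/eqP/rowP => i; rewrite mxE; apply/eqP; rewrite -sqrf_eq0.
have /psumr_eq0P/(_ w0 i isT) : forall i, true -> 0 <= w 0 i * w^T i 0.
  by move=> j _; rewrite mxE -expr2 sqr_ge0.
by rewrite mxE expr2 => ->.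
Qed.

(** [H] is the reflection in the hyperplane orthogonal to [w = v - e], which exchanges the unit
    vectors [v] and [e]. The case [v = e], where [w] vanishes, is served by the identity. *)
Lemma householder n (v : 'rV[R]_n.+1) : (v *m v^T) 0 0 = 1 ->
  exists2 Q, orthogonal_matrices Q & row 0 Q = v.
Proof.
move=> v1; pose e : 'rV[R]_n.+1 := delta_mx 0 0.
have [ve|ve] := eqVneq v e.
  by exists 1%:M; rewrite /orthogonal_matrices /= ?trmx1 ?mulmx1 // row1 ve.
have w0 : v - e != 0 by rewrite subr_eq0.
have := row_sqr_norm_gt0 w0; set w := v - e => wpos.
pose c := 2 / (w *m w^T) 0 0.
have we : (e *m w^T) 0 0 = v 0 0 - 1.
  by rewrite -rowE !mxE !eqxx.
have ww : (w *m w^T) 0 0 = 2 - 2 * v 0 0.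
  have mxB (M N : 'M[R]_1) : (M - N) 0 0 = M 0 0 - N 0 0 by rewrite !mxE.
  rewrite {1}/w mulmxBl mxB we {1}/w linearB /= mulmxBr mxB v1.
  have -> : (v *m e^T) 0 0 = v 0 0.
    by rewrite trmx_delta -colE mxE.
  ring.
have w2 : w *m w^T = ((w *m w^T) 0 0)%:M by exact: mx11_scalar.
pose H := 1%:M - c *: (w^T *m w).
have symH : H^T = H.
  by rewrite /H linearB /= trmx1 linearZ /= trmx_mul trmxK.
exists H; rewrite /orthogonal_matrices /=.
  have NN : (w^T *m w) *m (w^T *m w) = (w *m w^T) 0 0 *: (w^T *m w).
    by rewrite mulmxA -(mulmxA w^T w) [in LHS]w2 mul_mx_scalar -scalemxAl.
  have cw : c * (w *m w^T) 0 0 = 2 by rewrite divfK // gt_eqF.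
  rewrite symH /H mulmxBl mul1mx (mulmxBr (_ *: _)) mulmx1.
  rewrite -!scalemxAl -!scalemxAr NN !scalerA -mulrA cw.
  by apply/matrixP => i j; rewrite !mxE; ring.
rewrite rowE -/e /H mulmxBr mulmx1 -scalemxAr mulmxA (mx11_scalar (e *m w^T)).
rewrite we mul_scalar_mx scalerA.
(* Since [|w|^2 = 2 - 2 v_0], the scalar is -1 and [e H = e + w = v]. *)
have -> : c * (v 0 0 - 1) = -1.
  rewrite /c ww; field.
  by rewrite -ww gt_eqF.
by rewrite scaleN1r opprK /w addrC subrK.
Qed.

Lemma orthogonal1 n : orthogonal_matrices (1%:M : 'M[R]_n).
Proof. by rewrite /orthogonal_matrices /= trmx1 mulmx1. Qed.

Lemma orthogonal_mulmx_tr n (Q : 'M[R]_n) :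
  orthogonal_matrices Q -> Q *m Q^T = 1%:M.
Proof. exact: mulmx1C. Qed.

Lemma orthogonal_trmx n (Q : 'M[R]_n) :
  orthogonal_matrices Q -> orthogonal_matrices Q^T.
Proof. by rewrite /orthogonal_matrices /= trmxK; exact: mulmx1C. Qed.

Lemma orthogonal_mulmx n (P Q : 'M[R]_n) : orthogonal_matrices P ->
  orthogonal_matrices Q -> orthogonal_matrices (P *m Q).
Proof.
rewrite /orthogonal_matrices /= => PP QQ.
by rewrite trmx_mul !mulmxA -(mulmxA _ P^T) PP mulmx1.
Qed.

Lemma orthogonal_perm_mx n (s : 'S_n) :
  orthogonal_matrices (perm_mx s : 'M[R]_n).
Proof.
by rewrite /orthogonal_matrices /= tr_perm_mx -perm_mxM mulVg perm_mx1.
Qed.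

(** Deflation: conjugating by an orthogonal [Q] whose first row is a unit eigenvector leaves only
    the corner entry [a] in the first row. Symmetry clears the first column too, and induction
    treats the remaining block. *)
Lemma spectral_theorem n (A : 'M[R]_n) : A^T = A ->
  exists2 Q, orthogonal_matrices Q &
    exists y, A = Q *m diag_of_vector y *m Q^T.
Proof.
elim: n A => [|n IHn] A symA.
  exists 1%:M; first exact: orthogonal1.
  by exists 0; apply/matrixP => -[].
have [a [v0 v0A v0n]] := symmetric_eigenvector symA.
have v0pos := row_sqr_norm_gt0 v0n.
pose v := (Num.sqrt ((v0 *m v0^T) 0 0))^-1 *: v0.
have v1 : (v *m v^T) 0 0 = 1.
  rewrite /v linearZ /= -scalemxAl -scalemxAr scalerA mxE -invfM -expr2.
  by rewrite sqr_sqrtr ?ltW // mulVf // gt_eqF.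
have vA : v *m A = a *: v.
  by rewrite /v -scalemxAl v0A !scalerA mulrC.
have [Q oQ rQ] := householder v1.
pose B : 'M[R]_(1 + n) := Q *m A *m Q^T.
have symB : B^T = B by rewrite /B !trmx_mul trmxK symA mulmxA.
have rB : row 0 B = a *: delta_mx 0 0.
  rewrite /B rowE !mulmxA -rowE rQ vA -scalemxAl -rQ -row_mul.
  by rewrite orthogonal_mulmx_tr // row1.
have AE : A = Q^T *m B *m Q.
  by rewrite /B !mulmxA oQ mul1mx -mulmxA oQ mulmx1.
clearbody B.
have rB' (i j : 'I_(1 + n)) : i = 0 :> nat -> B i j = a *+ (j == 0 :> nat).
  move=> i0; have -> : i = 0 by exact: val_inj.
  by have /rowP/(_ j) := rB; rewrite !mxE eqxx mulr_natr.
have BE : B = block_mx a%:M 0 0 (drsubmx B).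
  rewrite -[LHS]submxK; congr block_mx.
  - by apply/matrixP => i j; rewrite (ord1 i) (ord1 j) !mxE rB'.
  - by apply/matrixP => i j; rewrite (ord1 i) !mxE rB'.
  - by apply/matrixP => i j; rewrite (ord1 j) -[B]symB !mxE rB'.
have symB' : (drsubmx B)^T = drsubmx B by rewrite trmx_drsub symB.
have [Q' oQ' [y' BE']] := IHn _ symB'.
pose U : 'M[R]_(1 + n) := block_mx 1%:M 0 0 Q'.
have oU : orthogonal_matrices U.
  rewrite /orthogonal_matrices /= /U tr_block_mx mulmx_block !trmx0 trmx1.
  rewrite !(mulmx0, mul0mx, mulmx1, addr0, add0r) oQ'.
  by rewrite -scalar_mx_block.
exists (Q^T *m U).
  by apply: orthogonal_mulmx => //; exact: orthogonal_trmx.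
exists (col_mx a%:M y' : 'cV_(1 + n)).
have -> : diag_of_vector (col_mx a%:M y' : 'cV_(1 + n)) =
    block_mx a%:M 0 0 (diag_of_vector y').
  rewrite /diag_of_vector tr_col_mx diag_mx_row; congr block_mx.
  by apply/matrixP => i j; rewrite (ord1 i) (ord1 j) !mxE.
have BU : B = U *m block_mx a%:M 0 0 (diag_of_vector y') *m U^T.
  rewrite BE BE' /U tr_block_mx !mulmx_block !trmx0 trmx1.
  by rewrite !(mulmx0, mul0mx, mulmx1, mul1mx, addr0, add0r).
by rewrite AE BU trmx_mul trmxK !mulmxA.
Qed.

End SpectralTheorem.

(** * Rearrangement inequality for doubly stochastic matrices *)

Section Rearrangement.
Variable R : realType.

(* Abel summation: [v] is the piecewise linear function of slopes [a] and
   breakpoints [y]. *)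
Lemma sorted_potential n (a y : 'I_n -> R) :
  {homo a : i j / (i <= j)%N >-> i <= j} ->
  {homo y : i j / (i <= j)%N >-> i <= j} ->
  exists v : 'I_n -> R, forall i j, a i * (y j - y i) <= v j - v i.
Proof.
case: n a y => [|n] a y ha hy; first by exists (fun=> 0) => -[].
pose a' k := a (inord k); pose y' k := y (inord k).
pose v' k := \sum_(0 <= l < k) a' l * (y' l.+1 - y' l).
have hy' k l : (k <= l <= n)%N -> y' k <= y' l.
  by move=> /andP[kl ln]; apply: hy; rewrite !inordK // ltnS (leq_trans kl).
have ha' k l : (k <= l <= n)%N -> a' k <= a' l.
  by move=> /andP[kl ln]; apply: ha; rewrite !inordK // ltnS (leq_trans kl).
(* Between [k] and [k + d] the slopes of [v'] lie between [a' k] and [a' (k + d)]. The lower bound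
   serves [i <= j], the upper one [j <= i]. *)
have up k d : (k + d <= n)%N ->
    a' k * (y' (k + d)%N - y' k) <= v' (k + d)%N - v' k /\
    v' (k + d)%N - v' k <= a' (k + d)%N * (y' (k + d)%N - y' k).
  elim: d => [|d IH]; first by rewrite addn0 !subrr !mulr0.
  rewrite addnS => kd; have [IH1 IH2] := IH (ltnW kd).
  have -> : v' (k + d).+1 =
      v' (k + d)%N + a' (k + d)%N * (y' (k + d).+1 - y' (k + d)%N).
    by rewrite /v' big_nat_recr.
  have y1 : y' (k + d)%N <= y' (k + d).+1 by rewrite hy' // leqnSn.
  have y2 : y' k <= y' (k + d)%N by rewrite hy' // leq_addr ltnW.
  have a1 : a' (k + d)%N <= a' (k + d).+1 by rewrite ha' // leqnSn.
  have a2 : a' k <= a' (k + d)%N by rewrite ha' // leq_addr ltnW.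
  split; nra.
exists (fun i => v' i) => i j.
have aE (k : 'I_n.+1) : a k = a' k by rewrite /a' inord_val.
have yE (k : 'I_n.+1) : y k = y' k by rewrite /y' inord_val.
rewrite aE !yE; have [ij|/ltnW ij] := leqP i j.
  by have := up i (j - i)%N; rewrite subnKC // => /(_ (ltn_ord j))[].
have := up j (i - j)%N; rewrite subnKC // => /(_ (ltn_ord i))[_ h].
nra.
Qed.

(** Since rows sum to 1, the difference of the two sides is the sum of
    [S i j * (a i * (y j - y i))]. The potential bounds it by the sum of [S i j * (v j - v i)],
    which vanishes because rows and columns both sum to 1. *)
Lemma sorted_doubly_stochastic_le n (a y : 'I_n -> R) (S : 'I_n -> 'I_n -> R) :
  {homo a : i j / (i <= j)%N >-> i <= j} ->
  {homo y : i j / (i <= j)%N >-> i <= j} ->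
  (forall i j, 0 <= S i j) ->
  (forall i, \sum_j S i j = 1) -> (forall j, \sum_i S i j = 1) ->
  \sum_i a i * (\sum_j S i j * y j) <= \sum_i a i * y i.
Proof.
move=> ha hy S0 Sr Sc; have [v hv] := sorted_potential ha hy.
rewrite -subr_le0 -sumrB.
rewrite (eq_bigr (fun i => \sum_j S i j * (a i * (y j - y i)))); last first.
  move=> i _; rewrite -[X in _ - _ * X]mul1r -(Sr i) mulr_suml -mulrBr -sumrB.
  by rewrite mulr_sumr; apply: eq_bigr => j _; ring.
have v0 : \sum_i \sum_j S i j * (v j - v i) = 0.
  under eq_bigr => i _ do under eq_bigr => j _ do rewrite mulrBr.
  under eq_bigr => i _ do rewrite sumrB.
  rewrite sumrB exchange_big /=.
  under eq_bigr => j _ do rewrite -mulr_suml Sc mul1r.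
  under [X in _ - X]eq_bigr => j _ do rewrite -mulr_suml Sr mul1r.
  by rewrite subrr.
rewrite -[leRHS]v0.
by apply: ler_sum => i _; apply: ler_sum => j _; rewrite ler_wpM2l.
Qed.

Lemma sort_vector n (y : 'I_n -> R) :
  exists s : 'S_n, {homo (y \o s) : i j / (i <= j)%N >-> i <= j}.
Proof.
pose t := [tuple y i | i < n].
have /tuple_permP[s sE] : perm_eq (sort <=%R t) t by rewrite perm_sort.
have tE (i : 'I_n) : nth 0 (sort <=%R t) i = y (s i).
  by rewrite sE -tnth_nth !tnth_mktuple.
exists s => i j ij /=; rewrite -!tE.
rewrite le_sorted_leq_nth ?sort_le_sorted //.
  by rewrite inE size_sort size_tuple ltn_ord.
by rewrite inE size_sort size_tuple ltn_ord.
Qed.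

End Rearrangement.

(** * Spectra up to permutation; [Phi] and [Psi] as mutually inverse maps *)

Section Spectrum.
Variables (R : realType) (n : nat).
Implicit Types (y z : 'cV[R]_n) (Q Y : 'M[R]_n) (E K : set 'M[R]_n).
Implicit Types (e k : set 'cV[R]_n).

Lemma diag_of_vector_sym y : (diag_of_vector y)^T = diag_of_vector y.
Proof. exact: tr_diag_mx. Qed.

Lemma diag_of_vectorK : cancel (@diag_of_vector R n) diag_of_matrix.
Proof. by move=> y; apply/colP => i; rewrite !mxE eqxx. Qed.

Lemma row_permKV (s : 'S_n) y : row_perm s (row_perm s^-1 y) = y.
Proof. by rewrite -row_permM mulgV row_perm1. Qed.

Lemma diag_of_vector_row_perm (s : 'S_n) y : diag_of_vector (row_perm s y) =
  perm_mx s *m diag_of_vector y *m (perm_mx s)^T.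
Proof.
rewrite tr_perm_mx -row_permE -col_permE; apply/matrixP => i j.
by rewrite !mxE (inj_eq perm_inj).
Qed.

Lemma conj_sym Q Y : Y^T = Y -> (Q *m Y *m Q^T)^T = Q *m Y *m Q^T.
Proof. by move=> sY; rewrite !trmx_mul trmxK sY mulmxA. Qed.

Lemma char_poly_conj_diag Q y : orthogonal_matrices Q ->
  char_poly (Q *m diag_of_vector y *m Q^T) = \prod_i ('X - (y i 0)%:P).
Proof.
move=> /orthogonal_mulmx_tr QQ.
transitivity (char_poly (diag_of_vector y)); last first.
  rewrite char_poly_trig ?diag_mx_is_trig //.
  by apply: eq_bigr => i _; rewrite !mxE eqxx.
pose P := map_mx (@polyC R) Q; pose PT := map_mx (@polyC R) Q^T.
have PP : P *m PT = 1%:M by rewrite -map_mxM QQ map_mx1.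
rewrite /char_poly.
have -> : char_poly_mx (Q *m diag_of_vector y *m Q^T) =
    P *m char_poly_mx (diag_of_vector y) *m PT.
  rewrite /char_poly_mx mulmxBr mulmxBl !map_mxM; congr (_ - _).
  by rewrite mul_mx_scalar -scalemxAl PP scalemx1.
by rewrite !det_mulmx mulrAC -det_mulmx PP det1 mul1r.
Qed.

(** Unique factorization: the linear factors determine the roots up to order. *)
Lemma prod_XsubC_row_perm y z :
  \prod_i ('X - (y i 0)%:P) = \prod_i ('X - (z i 0)%:P) ->
  exists s, y = row_perm s z.
Proof.
move=> yz; pose t (x : 'cV[R]_n) := [tuple x i 0 | i < n].
have tE x : \prod_(a <- t x) ('X - a%:P) = \prod_i ('X - (x i 0)%:P).
  by rewrite big_map big_enum.
have : perm_eq (t y) (t z) by apply: prod_XsubC_eq; rewrite !tE.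
move=> /tuple_permP[s sE]; exists s; apply/colP => i; rewrite mxE.
have /(congr1 (fun u : seq R => nth 0 u i)) := sE.
by rewrite -!tnth_nth !tnth_mktuple.
Qed.

(** Sorting [y] shows that an ordered spectrum exists, so [xget] does not fall back on its default;
    the characteristic polynomial then fixes the spectrum up to order. *)
Lemma ordered_spectrum_conj_diag Q y : orthogonal_matrices Q ->
  exists s, ordered_spectrum (Q *m diag_of_vector y *m Q^T) = row_perm s y.
Proof.
move=> oQ; set Y := Q *m _ *m _.
have [s ys] := sort_vector (fun i => y i 0).
have Ys : is_ordered_spectrum Y (row_perm s y).
  split; first by move=> i j ij; rewrite !mxE; exact: ys.
  rewrite char_poly_conj_diag // (reindex_inj (@perm_inj _ s)).
  by apply: eq_bigr => i _; rewrite mxE.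
have [_ YE] : is_ordered_spectrum Y (ordered_spectrum Y).
  by apply: xgetPex; exists (row_perm s y).
by apply: prod_XsubC_row_perm; rewrite -YE char_poly_conj_diag.
Qed.

Lemma conj_diag_row_perm Q y z : orthogonal_matrices Q ->
  diag_of_vector z = Q *m diag_of_vector y *m Q^T -> exists s, z = row_perm s y.
Proof.
move=> oQ zy; apply: prod_XsubC_row_perm.
rewrite -(char_poly_conj_diag y oQ) -zy.
by rewrite -(char_poly_conj_diag z (orthogonal1 R n)) mul1mx trmx1 mulmx1.
Qed.

Lemma symmetric_mxset_conj E Q Y : symmetric_mxset E ->
  orthogonal_matrices Q -> E Y -> E (Q *m Y *m Q^T).
Proof.
move=> [_ symE] oQ EY; rewrite (symE _ (orthogonal_trmx oQ)).
by exists Y => //; rewrite trmxK.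
Qed.

Lemma symmetric_mxset_conjE E Q Y : symmetric_mxset E ->
  orthogonal_matrices Q -> E (Q *m Y *m Q^T) -> E Y.
Proof.
move=> symE oQ /(symmetric_mxset_conj symE (orthogonal_trmx oQ)).
by rewrite trmxK !mulmxA oQ mul1mx -mulmxA oQ mulmx1.
Qed.

Lemma conj_symmetric_mxset E : E `<=` symmetric_matrices ->
  (forall Q Y, orthogonal_matrices Q -> E Y -> E (Q *m Y *m Q^T)) ->
  symmetric_mxset E.
Proof.
move=> Esym EQ; split=> // Q oQ; apply/seteqP; split=> [Y EY|_ [Y EY <-]].
  exists (Q *m Y *m Q^T); first exact: EQ.
  by rewrite !mulmxA oQ mul1mx -mulmxA oQ mulmx1.
by rewrite -{2}[Q]trmxK; apply: EQ => //; exact: orthogonal_trmx.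
Qed.

Lemma symmetric_vecset_row_perm e s y :
  symmetric_vecset e -> e y -> e (row_perm s y).
Proof.
move=> syme ey; rewrite (syme _ (perm_mx_is_perm _ s)).
by exists y => //; rewrite row_permE.
Qed.

Lemma row_perm_symmetric_vecset e :
  (forall s y, e y -> e (row_perm s y)) -> symmetric_vecset e.
Proof.
move=> es P /is_perm_mxP[s ->]; apply/seteqP; split=> [y ey|_ [y ey <-]].
  exists (row_perm s^-1 y); first exact: es.
  by rewrite -row_permE row_permKV.
by rewrite -row_permE; exact: es.
Qed.

Lemma symmetric_mxset_row_perm E s y : symmetric_mxset E ->
  E (diag_of_vector y) -> E (diag_of_vector (row_perm s y)).
Proof.
move=> symE Ey; rewrite diag_of_vector_row_perm.
by apply: symmetric_mxset_conj => //; exact: orthogonal_perm_mx.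
Qed.

(** A symmetric set contains a symmetric matrix [Y] exactly when it contains the diagonal matrix of
    the eigenvalues of [Y], in any order. *)
Lemma PhiE E : symmetric_mxset E -> Phi E = [set z | E (diag_of_vector z)].
Proof.
move=> symE; apply/seteqP; split=> [_ [_ /is_perm_mxP[t ->]] [Y EY <-]|z Ez].
  have [Q oQ [y YE]] := spectral_theorem (symE.1 _ EY); subst Y.
  have [s ->] := ordered_spectrum_conj_diag y oQ.
  rewrite -row_permE /=; do 2 apply: symmetric_mxset_row_perm => //.
  exact: symmetric_mxset_conjE EY.
have [s] := ordered_spectrum_conj_diag z (orthogonal1 R n).
rewrite mul1mx trmx1 mulmx1 => sE.
(* The ordered spectrum is [z] permuted by [s]; the inverse permutation restores [z]. *)
exists (perm_mx s^-1); first exact: perm_mx_is_perm.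
exists (diag_of_vector z) => //.
by rewrite sE -row_permE -row_permM mulVg row_perm1.
Qed.

Lemma Phi_symmetric E : symmetric_mxset E -> symmetric_vecset (Phi E).
Proof.
move=> symE; rewrite PhiE //; apply: row_perm_symmetric_vecset => s y.
exact: symmetric_mxset_row_perm.
Qed.

Lemma Psi_symmetric e : symmetric_mxset (Psi e).
Proof.
apply: conj_symmetric_mxset => [_ [Q _ [y _ <-]]|P _ oP [Q oQ [y ey <-]]].
  exact/conj_sym/diag_of_vector_sym.
exists (P *m Q); first exact: orthogonal_mulmx.
by exists y => //; rewrite trmx_mul !mulmxA.
Qed.

Lemma PhiK E : symmetric_mxset E -> Psi (Phi E) = E.
Proof.
move=> symE; rewrite PhiE //.
apply/seteqP; split=> [_ [Q oQ [y Ey <-]]|Y EY].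
  exact: symmetric_mxset_conj.
have [Q oQ [y YE]] := spectral_theorem (symE.1 _ EY).
exists Q => //; exists y => //=.
by apply: symmetric_mxset_conjE (oQ) _ => //; rewrite -YE.
Qed.

Lemma PsiK e : symmetric_vecset e -> Phi (Psi e) = e.
Proof.
move=> syme; rewrite PhiE; last exact: Psi_symmetric.
apply/seteqP; split=> [z [Q oQ [y ey /esym zy]]|z ez].
  have [s ->] := conj_diag_row_perm oQ zy.
  exact: symmetric_vecset_row_perm.
exists 1%:M; first exact: orthogonal1.
by exists z => //; rewrite mul1mx trmx1 mulmx1.
Qed.

End Spectrum.

(** * Continuity of matrix operations and compactness of the orthogonal group *)

Section MatrixContinuity.
Variables (R : realType) (T : topologicalType).

(** Neighbourhoods of a matrix are generated by entrywise ones, and there are finitely many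
    entries. *)
Lemma mx_continuous m n (f : T -> 'M[R]_(m, n)) :
  (forall i j, continuous (fun x => f x i j)) -> continuous f.
Proof.
move=> fc x A [P fxP PA].
have : \forall y \near x, forall i j, P i j (f y i j).
  apply: filter_forall => i; apply: filter_forall => j.
  exact: (fc i j x _ (fxP i j)).
by apply: filterS => y Py; exact: PA.
Qed.

Lemma coord_continuous_comp m n (f : T -> 'M[R]_(m, n)) i j :
  continuous f -> continuous (fun x => f x i j).
Proof.
move=> fc x; apply: (@continuous_comp _ _ _ f (fun M : 'M[R]_(m, n) => M i j)).
  exact: fc.
exact: coord_continuous.
Qed.

Lemma mulmx_continuous m n p (f : T -> 'M[R]_(m, n)) (g : T -> 'M[R]_(n, p)) :
  continuous f -> continuous g -> continuous (fun x => f x *m g x).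
Proof.
move=> fc gc; apply: mx_continuous => i j.
under eq_fun do rewrite mxE.
apply: continuous_big => [|k _ x]; first exact: add_continuous.
by apply: cvgM; exact: coord_continuous_comp.
Qed.

Lemma trmx_continuous m n (f : T -> 'M[R]_(m, n)) :
  continuous f -> continuous (fun x => (f x)^T).
Proof.
move=> fc; apply: mx_continuous => i j; under eq_fun do rewrite mxE.
exact: coord_continuous_comp.
Qed.

Lemma diag_of_vector_continuous n (f : T -> 'cV[R]_n) :
  continuous f -> continuous (fun x => diag_of_vector (f x)).
Proof.
move=> fc; apply: mx_continuous => i j; under eq_fun do rewrite !mxE.
have [_|_] := eqVneq i j; last by move=> x; exact: cvg_cst.
exact: coord_continuous_comp.
Qed.

Lemma diag_of_matrix_continuous n (f : T -> 'M[R]_n) :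
  continuous f -> continuous (fun x => diag_of_matrix (f x)).
Proof.
move=> fc; apply: mx_continuous => i j; under eq_fun do rewrite mxE.
exact: coord_continuous_comp.
Qed.

End MatrixContinuity.

(** Orthogonality is a closed condition inside the cube of matrices with entries in [[-1, 1]], which
    is the image under [vec_mx] of a compact product of segments. *)
Lemma orthogonal_matrices_compact (R : realType) n :
  compact (@orthogonal_matrices R n).
Proof.
pose C := [set v : 'rV[R]_(n * n) | forall i, `[(-1 : R), 1]%classic (v 0 i)].
have vec_mx_cont : continuous (@vec_mx R n n).
  apply: mx_continuous => i j.
  by under eq_fun do rewrite mxE; exact: coord_continuous.
have cC : compact (vec_mx @` C).
  apply: continuous_compact; first exact: continuous_subspaceT.
  apply: (@rV_compact R _ (fun=> `[-1, 1]%classic)) => _.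
  exact: segment_compact.
apply: subclosed_compact cC _.
  have -> : @orthogonal_matrices R n = (fun Q => Q^T *m Q) @^-1` [set 1%:M].
    by [].
  have idc : continuous (@id ('M[R]_n)) by move=> Q; exact: cvg_id.
  apply: preimage_closed => [Q _|].
    exact: (mulmx_continuous (trmx_continuous idc) idc).
  exact/accessible_closed_set1/hausdorff_accessible/norm_hausdorff.
move=> Q oQ; exists (mxvec Q); last exact: mxvecK.
move=> k; case/mxvec_indexP: k => i j; rewrite mxvecE /= in_itv /= -ler_norml.
rewrite -(@expr_le1 _ 2) // -normrX ger0_norm ?sqr_ge0 //.
(* The square of an entry is at most the squared norm of its column, which is 1. *)
have /matrixP/(_ j j) := oQ; rewrite !mxE eqxx => QQ; rewrite -[leRHS]QQ.
rewrite (bigD1 i) //= mxE -expr2 lerDl sumr_ge0 // => k _.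
by rewrite mxE -expr2 sqr_ge0.
Qed.

(** * Convex bodies under [Phi] and [Psi] *)

Section ConvexBodies.
Variable R : realType.

Lemma convex_setP (V : lmodType R) (A : set V) : convex_set A <->
  forall x y t, A x -> A y -> 0 <= t <= 1 -> A (t *: x + (1 - t) *: y).
Proof.
split=> [cA x y t Ax Ay /andP[t0 t1]|cA x y t].
  exact: set_mem (cA x y (Itv01 t0 t1) (mem_set Ax) (mem_set Ay)).
move=> /set_mem Ax /set_mem Ay; apply/mem_set; apply: cA => //.
by rewrite ge0 le1.
Qed.

Section Diagonal.
Variable n : nat.
Implicit Types (u x y z : 'cV[R]_n) (Q Y : 'M[R]_n) (K : set 'M[R]_n).
Implicit Types (k : set 'cV[R]_n).

Lemma diag_of_matrixZD t Y Z : diag_of_matrix (t *: Y + (1 - t) *: Z) =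
  t *: diag_of_matrix Y + (1 - t) *: diag_of_matrix Z.
Proof. by apply/colP => i; rewrite !mxE. Qed.

(* Averaging [Y] with its conjugate by the reflection in the [m]-th coordinate
   hyperplane kills the off-diagonal entries of row and column [m]. *)
Lemma symmetric_convex_diag K Y : symmetric_mxset K -> convex_set K -> K Y ->
  K (diag_of_vector (diag_of_matrix Y)).
Proof.
move=> symK /convex_setP cK KY.
(* [T m] keeps the off-diagonal entries whose two indices are at least [m], so [T 0] is [Y] and
   [T n] its diagonal part. *)
pose T m := \matrix_(i, j)
  (if (i == j) || ((m <= i) && (m <= j))%N then Y i j else 0).
have -> : diag_of_vector (diag_of_matrix Y) = T n.
  apply/matrixP => i j; rewrite !mxE leqNgt ltn_ord orbF.
  by case: eqP => [->|].
suff KT m : (m <= n)%N -> K (T m) by exact: KT.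
elim: m => [_|m IHm mn].
  have -> // : T 0%N = Y.
  by apply/matrixP => i j; rewrite mxE orbT.
pose D : 'M[R]_n := diag_mx (\row_i (-1) ^+ (val i == m)).
have DT : D^T = D by exact: tr_diag_mx.
have oD : orthogonal_matrices D.
  rewrite /orthogonal_matrices /= DT mulmx_diag; apply/matrixP => i j.
  by rewrite !mxE -expr2 sqrr_sign.
have KTm := IHm (ltnW mn).
(* Conjugation by [D] changes the sign of exactly the off-diagonal entries in row or column [m]; the
   midpoint cancels them. *)
have -> : T m.+1 = 2^-1 *: T m + (1 - 2^-1) *: (D *m T m *m D^T).
  rewrite DT mul_mx_diag mul_diag_mx; apply/matrixP => i j; rewrite !mxE.
  have [->|ij] := eqVneq i j.
    by rewrite /=; case: (_ == m) => /=; field.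
  rewrite /= [in LHS]ltn_neqAle [(m < j)%N]ltn_neqAle !(eq_sym m).
  have [im|im] := eqVneq (val i) m.
    have jm : (val j == m) = false.
      by apply/negbTE; rewrite -im eq_sym.
    by rewrite im jm leqnn /=; case: ifP => _; field.
  have [jm|jm] := eqVneq (val j) m.
    by rewrite jm leqnn /= andbF andbT; case: ifP => _; field.
  by rewrite /=; case: ifP => _; field.
apply: cK => //; last by rewrite invr_ge0 ler0n invf_le1 ?ltr0n // ler1n.
exact: symmetric_mxset_conj.
Qed.

Lemma Phi_convex_diag K : symmetric_mxset K -> convex_set K ->
  Phi K = [set diag_of_matrix Y | Y in K].
Proof.
move=> symK cK; rewrite PhiE //; apply/seteqP; split=> [z Kz|_ [Y KY <-]].
  by exists (diag_of_vector z) => //; exact: diag_of_vectorK.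
exact: symmetric_convex_diag.
Qed.

Lemma Phi_convex_body K : symmetric_mxset K -> convex_body_mx K ->
  convex_body_vec (Phi K).
Proof.
move=> symK [_ [Y KY] cK compK]; rewrite Phi_convex_diag //; split.
- by exists (diag_of_matrix Y), Y.
- apply/convex_setP => _ _ t [Y1 KY1 <-] [Y2 KY2 <-] t01.
  exists (t *: Y1 + (1 - t) *: Y2); first exact: (convex_setP K).1.
  exact: diag_of_matrixZD.
- apply: continuous_compact compK; apply: continuous_subspaceT.
  apply: (@diag_of_matrix_continuous _ _ _ id) => M; exact: cvg_id.
Qed.

(** The distance is Euclidean so that minimality can be turned into an inner-product inequality; its
    square is continuous and attains its minimum. *)
Lemma compact_nearest_point k x : k !=set0 -> compact k ->
  exists2 z, k z & forall u, k u ->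
    \sum_i (x i 0 - z i 0) ^+ 2 <= \sum_i (x i 0 - u i 0) ^+ 2.
Proof.
move=> k0 kc; pose q (u : 'cV[R]_n) := \sum_i (x i 0 - u i 0) ^+ 2.
have qc : continuous q.
  apply: continuous_big => [|i _ u]; first exact: add_continuous.
  apply: (@continuous_comp _ _ _ (fun u : 'cV[R]_n => x i 0 - u i 0)
    (fun r => r ^+ 2)); last exact: exprn_continuous.
  apply: continuousB; last exact: coord_continuous.
  by apply: cvg_cst; exact: nbhs_filter.
have [z zk zq] := compact_EVT_min k0 kc (continuous_subspaceT qc).
by exists z => [|u ku]; [exact/set_mem|exact/zq/mem_set].
Qed.

(* If [x = S y] were outside [k], let [z] be its nearest point in [k] and
   [a = x - z], so that [<a, u> <= <a, z>] on [k]. Testing with the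
   rearrangement [u] of [y] sorted like [a] yields
   [<a, x> <= <a, u> <= <a, z>], that is [<a, a> <= 0]. *)
Lemma symmetric_convex_doubly_stochastic k y (S : 'I_n -> 'I_n -> R) :
  symmetric_vecset k -> convex_set k -> compact k -> k y ->
  (forall i j, 0 <= S i j) ->
  (forall i, \sum_j S i j = 1) -> (forall j, \sum_i S i j = 1) ->
  k (\col_i \sum_j S i j * y j 0).
Proof.
move=> symk /convex_setP ck kc ky S0 Sr Sc; set x := \col_i _.
have [z kz zmin] := compact_nearest_point x (ex_intro _ y ky) kc.
pose a i := x i 0 - z i 0.
have obtuse u : k u -> \sum_i a i * (u i 0 - z i 0) <= 0.
  move=> ku; set p := \sum_i _; set r := \sum_i (u i 0 - z i 0) ^+ 2.
  have r0 : 0 <= r by apply: sumr_ge0 => i _; exact: sqr_ge0.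
  (* Compare [z] with [t *: u + (1 - t) *: z], at squared distance [|a|^2 - 2 t p + t^2 r] from
     [x]. *)
  have zt t : 0 <= t <= 1 -> 2 * t * p <= t ^+ 2 * r.
    move=> t01; have h := zmin _ (ck _ _ t ku kz t01).
    rewrite -subr_ge0 -sumrB in h; rewrite -subr_ge0.
    apply: le_trans h _; rewrite le_eqVlt; apply/orP; left; apply/eqP.
    rewrite /p /r !mulr_sumr -sumrB; apply: eq_bigr => i _.
    by rewrite /a !mxE; ring.
  have [//|p0] := leP p 0; exfalso.
  have pr0 : 0 < p + r by lra.
  (* For [p > 0] the bound [zt] fails at small [t]. With this choice [t r = p - t p < p], whereas
     [zt] gives [2 p <= t r]; the denominator is positive even when [r = 0]. *)
  pose t := p / (p + r).
  have t0 : 0 < t by rewrite divr_gt0.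
  have t1 : t <= 1 by rewrite ler_pdivrMr // mul1r lerDl.
  have tp : 2 * t * p <= t ^+ 2 * r by rewrite zt // t1 ltW.
  have tE : t * (p + r) = p by rewrite divfK // gt_eqF.
  have : 2 * p <= t * r.
    by rewrite -(ler_pM2l t0); move: tp; rewrite expr2; lra.
  have : 0 < t * p by rewrite mulr_gt0.
  by move: tE; rewrite mulrDr; lra.
have [s as_] := sort_vector a.
have [t yt] := sort_vector (fun i => y i 0).
(* [u] takes at [s i] the value of [y] at [t i], so the same permutation [s] sorts both [a] and
   [u]. *)
pose u := row_perm s^-1 (row_perm t y).
have ku : k u by do 2 apply: symmetric_vecset_row_perm => //.
have ax_le : \sum_i a i * x i 0 <= \sum_i a i * u i 0.
  (* Permuting rows by [s] and columns by [t] keeps [S] doubly stochastic and lets both vectors be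
     sorted. *)
  have h := @sorted_doubly_stochastic_le R n _ _
    (fun i j => S (s i) (t j)) as_ yt (fun i j => S0 (s i) (t j)).
  rewrite (reindex_inj (@perm_inj _ s)) [leRHS](reindex_inj (@perm_inj _ s)).
  apply: (le_trans _ (le_trans (h _ _) _)) => [|i|j|].
  - apply: ler_sum => i _; rewrite mxE /= (reindex_inj (@perm_inj _ t)).
    exact: lexx.
  - by rewrite -(Sr (s i)) [RHS](reindex_inj (@perm_inj _ t)).
  - by rewrite -(Sc (t j)) [RHS](reindex_inj (@perm_inj _ s)).
  - by apply: ler_sum => i _; rewrite !mxE permK.
have aa : \sum_i a i ^+ 2 = 0.
  apply/eqP; rewrite eq_le sumr_ge0 ?andbT => [|i _]; last exact: sqr_ge0.
  apply: le_trans (obtuse _ ku); rewrite -subr_ge0 -sumrB.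
  rewrite -subr_ge0 -sumrB in ax_le; apply: (le_trans ax_le).
  by apply: ler_sum => i _; rewrite /a; lra.
suff -> : x = z by [].
apply/colP => i; apply/eqP; rewrite -subr_eq0 -sqrf_eq0; apply/eqP.
by have /psumr_eq0P/(_ aa i isT) := fun i (_ : true) => sqr_ge0 (a i).
Qed.

Lemma symmetric_convex_diag_conj k Q y : symmetric_vecset k -> convex_set k ->
  compact k -> orthogonal_matrices Q -> k y ->
  k (diag_of_matrix (Q *m diag_of_vector y *m Q^T)).
Proof.
move=> symk ck kc oQ ky.
have -> : diag_of_matrix (Q *m diag_of_vector y *m Q^T) =
    \col_i \sum_j Q i j ^+ 2 * y j 0.
  apply/colP => i; rewrite /diag_of_vector mul_mx_diag !mxE.
  by apply: eq_bigr => j _; rewrite !mxE; ring.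
apply: symmetric_convex_doubly_stochastic => // [i j|i|j].
- exact: sqr_ge0.
- have /matrixP/(_ i i) := orthogonal_mulmx_tr oQ.
  rewrite !mxE eqxx => QQ; rewrite -[RHS]QQ.
  by apply: eq_bigr => j _; rewrite mxE expr2.
- have /matrixP/(_ j j) := oQ; rewrite !mxE eqxx => QQ; rewrite -[RHS]QQ.
  by apply: eq_bigr => i _; rewrite mxE expr2.
Qed.

Lemma Psi_convex_body k : symmetric_vecset k -> convex_body_vec k ->
  convex_body_mx (Psi k).
Proof.
move=> symk [[y0 ky0] ck kc]; have symP := Psi_symmetric k; split.
- exact: symP.1.
- exists (1%:M *m diag_of_vector y0 *m 1%:M^T), 1%:M.
    exact: orthogonal1.
  by exists y0.
- apply/convex_setP => _ _ t [Q1 oQ1 [y1 ky1 <-]] [Q2 oQ2 [y2 ky2 <-]] t01.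
  set Y1 := Q1 *m _ *m _; set Y2 := Q2 *m _ *m _.
  have symY : (t *: Y1 + (1 - t) *: Y2)^T = t *: Y1 + (1 - t) *: Y2.
    by rewrite linearD !linearZ /= !conj_sym ?diag_of_vector_sym.
  have [U oU [w wE]] := spectral_theorem symY.
  have wE' : diag_of_vector w =
      t *: (U^T *m Y1 *m U) + (1 - t) *: (U^T *m Y2 *m U).
    transitivity (U^T *m (t *: Y1 + (1 - t) *: Y2) *m U).
      by rewrite wE !mulmxA oU mul1mx -mulmxA oU mulmx1.
    by rewrite mulmxDr mulmxDl -!scalemxAr -!scalemxAl.
  exists U => //; exists w => //.
  (* [w] is the same convex combination of the diagonals of two conjugates, and each of these
     diagonals lies in [k]. *)
  rewrite -[w]diag_of_vectorK wE' diag_of_matrixZD.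
  have conjU Q y : U^T *m (Q *m diag_of_vector y *m Q^T) *m U =
      (U^T *m Q) *m diag_of_vector y *m (U^T *m Q)^T.
    by rewrite trmx_mul trmxK !mulmxA.
  by apply: ((convex_setP k).1 ck) => //; rewrite conjU;
    apply: symmetric_convex_diag_conj => //; apply: orthogonal_mulmx => //;
    exact: orthogonal_trmx.
(* Compactness: [Psi k] is a continuous image of the product of the orthogonal group and [k]. *)
- pose f (p : 'M[R]_n * 'cV[R]_n) := p.1 *m diag_of_vector p.2 *m p.1^T.
  have -> : Psi k = f @` (orthogonal_matrices `*` k).
    apply/seteqP; split=> [_ [Q oQ [y ky <-]]|_ [[Q y] [/= oQ ky] <-]].
      by exists (Q, y).
    by exists Q => //; exists y.
  apply: continuous_compact; last first.
    by apply: compact_setX => //; exact: orthogonal_matrices_compact.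
  apply: continuous_subspaceT; apply: mulmx_continuous.
    apply: mulmx_continuous; first by move=> p; exact: cvg_fst.
    by apply: diag_of_vector_continuous => p; exact: cvg_snd.
  by apply: trmx_continuous => p; exact: cvg_fst.
Qed.

End Diagonal.
End ConvexBodies.

Theorem proposition3p1p1 (R : realType) (n : nat) (hn : (2 <= n)%N) :
  [/\ set_bij [set E : set 'M[R]_n | symmetric_mxset E]
              [set e : set 'cV[R]_n | symmetric_vecset e] Phi,
      (forall e : set 'cV[R]_n, symmetric_vecset e ->
         symmetric_mxset (Psi e) /\ Phi (Psi e) = e),
      (forall E : set 'M[R]_n, symmetric_mxset E -> Psi (Phi E) = E),
      (forall K : set 'M[R]_n, symmetric_mxset K -> convex_body_mx K ->
         Phi K = [set diag_of_matrix Y | Y in K]) &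
      set_bij [set K : set 'M[R]_n | symmetric_mxset K /\ convex_body_mx K]
              [set k : set 'cV[R]_n | symmetric_vecset k /\ convex_body_vec k]
              Phi].
Proof.
(* [Psi] is a left inverse of [Phi] on symmetric sets; this injectivity also serves the convex
   bodies. *)
have Phi_inj : {in [set E : set 'M[R]_n | symmetric_mxset E] &, injective Phi}.
  move=> E F /set_mem symE /set_mem symF EF.
  by rewrite -(PhiK symE) EF PhiK.
split.
- split=> // [E|e syme]; first exact: Phi_symmetric.
  by exists (Psi e); [exact: Psi_symmetric|exact: PsiK].
- by move=> e syme; split; [exact: Psi_symmetric|exact: PsiK].
- by move=> E; exact: PhiK.
- by move=> K symK [_ _ cK _]; exact: Phi_convex_diag.
- split.
  + move=> K [symK bK]; split; first exact: Phi_symmetric.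
    exact: Phi_convex_body.
  + move=> K L /set_mem[symK _] /set_mem[symL _].
    by apply: Phi_inj; exact: mem_set.
  + move=> k [symk bk]; exists (Psi k); last exact: PsiK.
    by split; [exact: Psi_symmetric|exact: Psi_convex_body].
Qed.
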